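(* Under the assumptions below, suppose $\mu$ is sufficiently large. The data $(X_i,U_i,\mathcal{E}_i)$ are informative for the cooperative output regulation problem if, for every $i\in\{1,\dots,N\}$, there exists a right inverse $X_i^{+}$ of $X_i$ such that $(X_i\mathcal{D}_{11}-E_iV)X_i^{+}$ is stable and the data-driven transmission zero condition $\mathrm{rank}\begin{bmatrix}X_i\mathcal{D}_{11}-E_iV-\lambda_S X_i\\ \mathcal{E}_i-F_iV\end{bmatrix}=n_i+p$ holds for all $\lambda_S\in\sigma(S)$.
   Context: Leader–follower multi-agent system with $N$ followers. Follower $i$: $\dot x_i=A_ix_i+B_iu_i+E_iv$, $e_i=C_ix_i+D_iu_i+F_iv$ (tracking error), with $x_i\in\mathbb{R}^{n_i}$, $e_i\in\mathbb{R}^{p}$; exosystem $\dot v=Sv$, $v\in\mathbb{R}^q$. $A_i,B_i,C_i,D_i$ are unknown; $E_i,F_i,S$ are known. Distributed controller: $u_i=K_{1i}x_i+K_{2i}\eta_i$, $\dot\eta_i=S\eta_i+\mu[\sum_j a_{ij}(\eta_j-\eta_i)+a_{i0}(v-\eta_i)]$. Data: signals expanded in an orthogonal polynomial basis truncated at degree $N$; $X_i,U_i,\mathcal{E}_i,V$ are the matrices of the first $N+1$ coefficient vectors of $x_i,u_i,e_i,v$, and $\mathcal{D}_{11}$ is the leading $(N+1)\times(N+1)$ block of the basis differentiation matrix. Exact data: $X_i\mathcal{D}_{11}=A_iX_i+B_iU_i+E_iV$, $\mathcal{E}_i=C_iX_i+D_iU_i+F_iV$. The data are informative for cooperative output regulation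 if every system $(A_i,B_i,C_i,D_i)$ consistent with the data admits gains $K_{1i},K_{2i}$ and $\mu$ such that the closed-loop matrix is Hurwitz and $e(t)\to0$ (here certified via the model-based transmission-zero condition $\mathrm{rank}\begin{bmatrix}A_i-\lambda_SI&B_i\\C_i&D_i\end{bmatrix}=n_i+p$ for all consistent systems). Assumptions: $S$ has no eigenvalues with negative real part; the graph is unknown but contains a directed spanning tree rooted at the leader; nonzero Laplacian entries satisfy $\varepsilon_1\le|\mathcal{L}_{ij}|\le\varepsilon_2$. *)

(* Defs.v *)
From HB Require Import structures.
From mathcomp Require Import all_boot all_order all_algebra.
From mathcomp Require Import all_classical all_reals all_analysis.
From mathcomp.real_closed Require Import complex.
Set Implicit Arguments. Unset Strict Implicit. Unset Printing Implicit Defensive.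
Import Order.TTheory GRing.Theory Num.Theory.
Import numFieldNormedType.Exports.
Local Open Scope ring_scope.
Local Open Scope classical_set_scope.

Definition is_eig (R : realType) (m : nat) (M : 'M[R]_m) (lam : R[i]) : Prop :=
  root (map_poly (real_complex R) (char_poly M)) lam.

Definition hurwitz (R : realType) (m : nat) (M : 'M[R]_m) : Prop :=
  forall lam : R[i], is_eig M lam -> complex.Re lam < 0.

(* Communication graph: N followers (indexed by 'I_N), one leader.       *)
(* a i j  : weight of edge j -> i between followers,                      *)
(* a0 i   : weight of edge leader -> follower i.                          *)
(* Augmented graph on 'I_N.+1, node ord0 = leader, node lift ord0 i = i.  *)

Definition aug_adj (R : realType) (N : nat) (a : 'M[R]_N) (a0 : 'cV[R]_N)
  : 'M[R]_N.+1 :=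
  \matrix_(r < N.+1, c < N.+1)
    match unlift ord0 r, unlift ord0 c with
    | Some i, Some j => a i j
    | Some i, None => a0 i 0
    | None, _ => 0
    end.

Definition aug_laplacian (R : realType) (N : nat) (a : 'M[R]_N) (a0 : 'cV[R]_N)
  : 'M[R]_N.+1 :=
  diag_mx (\row_(r < N.+1) \sum_(c < N.+1) aug_adj a a0 r c) - aug_adj a a0.

Definition aug_edge (R : realType) (N : nat) (a : 'M[R]_N) (a0 : 'cV[R]_N)
  : rel 'I_N.+1 := fun c r => aug_adj a a0 r c != 0.

Definition spanning_tree_from_leader (R : realType) (N : nat)
  (a : 'M[R]_N) (a0 : 'cV[R]_N) : Prop :=
  forall r : 'I_N.+1, connect (aug_edge a a0) ord0 r.

Definition admissible_graph (R : realType) (N : nat) (eps1 eps2 : R)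
  (a : 'M[R]_N) (a0 : 'cV[R]_N) : Prop :=
  [/\ (forall i j, 0 <= a i j), (forall i, 0 <= a0 i 0), (forall i, a i i = 0),
      spanning_tree_from_leader a a0 &
      (forall r c, aug_laplacian a a0 r c != 0 ->
         eps1 <= `|aug_laplacian a a0 r c| <= eps2)].

(*   u_i = K1_i x_i + K2_i eta_i,                                        *)
(*   eta_i' = S eta_i + mu [ sum_j a_ij (eta_j - eta_i) + a_i0 (v - eta_i) ] *)
(* Closed-loop matrix of the stacked state (x_1..x_N, eta_1..eta_N):     *)
(*   [ diag(A_i + B_i K1_i)      diag(B_i K2_i)                    ]     *)
(*   [ 0                          I (x) S - mu (H (x) I_q)          ]     *)
(* with H = L_followers + diag(a_i0).                                    *)

Definition closed_loop (R : realType) (N : nat) (n m : 'I_N -> nat) (q : nat)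
  (A : forall i, 'M[R]_(n i)) (B : forall i, 'M[R]_(n i, m i))
  (K1 : forall i, 'M[R]_(m i, n i)) (K2 : forall i, 'M[R]_(m i, q))
  (S : 'M[R]_q) (mu : R) (a : 'M[R]_N) (a0 : 'cV[R]_N)
  : 'M[R]_(\sum_(i < N) n i + \sum_(i < N) q) :=
  block_mx
    (\mxdiag_(i < N) (A i + B i *m K1 i))
    (\mxblock_(i < N, j < N) (if i == j then B i *m K2 i else 0))
    0
    (\mxblock_(i < N, j < N)
       (if i == j then S - (mu * (\sum_(k < N) a i k + a0 i 0)) *: 1%:M
        else (mu * a i j) *: 1%:M)).

Definition output_regulated (R : realType) (N : nat) (n m : 'I_N -> nat) (p q : nat)
  (A : forall i, 'M[R]_(n i)) (B : forall i, 'M[R]_(n i, m i))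
  (C : forall i, 'M[R]_(p, n i)) (D : forall i, 'M[R]_(p, m i))
  (E : forall i, 'M[R]_(n i, q)) (F : forall i, 'M[R]_(p, q))
  (K1 : forall i, 'M[R]_(m i, n i)) (K2 : forall i, 'M[R]_(m i, q))
  (S : 'M[R]_q) (mu : R) (a : 'M[R]_N) (a0 : 'cV[R]_N) : Prop :=
  forall (x : forall i, R -> 'cV[R]_(n i)) (eta : 'I_N -> R -> 'cV[R]_q)
         (v : R -> 'cV[R]_q),
    (forall t : R, is_derive t (1 : R) v (S *m v t)) ->
    (forall i (t : R), is_derive t (1 : R) (x i)
        (A i *m x i t + B i *m (K1 i *m x i t + K2 i *m eta i t) + E i *m v t)) ->
    (forall i (t : R), is_derive t (1 : R) (eta i)
        (S *m eta i t + mu *: (\sum_(j < N) a i j *: (eta j t - eta i t)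
                               + a0 i 0 *: (v t - eta i t)))) ->
    forall i : 'I_N,
      (C i *m x i t + D i *m (K1 i *m x i t + K2 i *m eta i t) + F i *m v t)
        @[t --> +oo] --> (0 : 'cV[R]_p).

Definition consistent (R : realType) (ni mi p q d : nat)
  (Dd : 'M[R]_d.+1) (V : 'M[R]_(q, d.+1))
  (Ei : 'M[R]_(ni, q)) (Fi : 'M[R]_(p, q))
  (Xi : 'M[R]_(ni, d.+1)) (Ui : 'M[R]_(mi, d.+1)) (Ecal : 'M[R]_(p, d.+1))
  (Ai : 'M[R]_ni) (Bi : 'M[R]_(ni, mi)) (Ci : 'M[R]_(p, ni)) (Di : 'M[R]_(p, mi))
  : Prop :=
  Xi *m Dd = Ai *m Xi + Bi *m Ui + Ei *m V /\
  Ecal = Ci *m Xi + Di *m Ui + Fi *m V.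

Definition informative_COR (R : realType) (N : nat) (n m : 'I_N -> nat) (p q d : nat)
  (S : 'M[R]_q) (E : forall i, 'M[R]_(n i, q)) (F : forall i, 'M[R]_(p, q))
  (Dd : 'M[R]_d.+1) (V : 'M[R]_(q, d.+1))
  (X : forall i, 'M[R]_(n i, d.+1)) (U : forall i, 'M[R]_(m i, d.+1))
  (Ecal : forall i, 'M[R]_(p, d.+1)) (eps1 eps2 : R) : Prop :=
  forall (A : forall i, 'M[R]_(n i)) (B : forall i, 'M[R]_(n i, m i))
         (C : forall i, 'M[R]_(p, n i)) (D : forall i, 'M[R]_(p, m i)),
    (forall i, consistent Dd V (E i) (F i) (X i) (U i) (Ecal i) (A i) (B i) (C i) (D i)) ->
    exists (K1 : forall i, 'M[R]_(m i, n i)) (K2 : forall i, 'M[R]_(m i, q)) (mu : R),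
      forall (a : 'M[R]_N) (a0 : 'cV[R]_N),
        admissible_graph eps1 eps2 a a0 ->
        hurwitz (closed_loop A B K1 K2 S mu a a0) /\
        output_regulated A B C D E F K1 K2 S mu a a0.

(* Main.v *)
Require Import Defs.
From HB Require Import structures.
From mathcomp Require Import all_boot all_order all_algebra.
From mathcomp Require Import all_classical all_reals all_analysis.
From mathcomp.real_closed Require Import complex.
From mathcomp Require Import ring lra.
Import Order.TTheory GRing.Theory Num.Theory.
Import numFieldNormedType.Exports.
Local Open Scope ring_scope.

(** With [K1_i := U_i X_i^+] the data equations give [A_i + B_i K1_i = (X_i D - E_i V) X_i^+],
    which is Hurwitz.  The data rank condition factors through the matrix
    [[A_i - lam, B_i; C_i, D_i]], so that matrix has full row rank on the spectrum of [S] and the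
    regulator equations have a solution [(Pi_i, Gam_i)]; put [K2_i := Gam_i - K1_i Pi_i].
    Then [(x_i - Pi_i v, eta_i - v)] solves the autonomous system of the closed-loop matrix and
    [e_i] is a linear function of it.  An eigenvalue of the observer block is [sig - mu * xi]
    with [sig] in the spectrum of [S] and [xi] in that of the grounded Laplacian; weights
    [1 - theta ^ k], with [k] the distance to the leader, bound [Re xi] away from 0 uniformly over
    the admissible graphs, so one [mu] serves all of them. *)

(** * Spectral induction *)

(* By Cayley-Hamilton the product of the [M - s%:M] over the spectrum kills every row. *)
Lemma row_eigen_ind {F : closedFieldType} {n : nat} (M : 'M[F]_n) (P : 'rV[F]_n -> Prop) :
  P 0 ->
  (forall (s : F) (r : 'rV_n), eigenvalue M s -> P (r *m (M - s%:M)) -> P r) ->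
  forall r, P r.
Proof.
case: n M P => [|n] M P P0 step r; first by rewrite (thinmx0 r).
have [s def_s] := closed_field_poly_normal (char_poly M).
rewrite (monicP (char_poly_monic M)) scale1r in def_s.
have eig_s z : z \in s -> eigenvalue M z.
  by rewrite eigenvalue_root_char def_s root_prod_XsubC.
have: r *m horner_mx M (\prod_(z <- s) ('X - z%:P)) = 0.
  by rewrite -def_s Cayley_Hamilton mulmx0.
elim: s {def_s} eig_s r => [|z s IHs] eig_s r.
  by rewrite big_nil rmorph1 mulmx1 => ->.
rewrite big_cons rmorphM rmorphB /= horner_mx_X horner_mx_C -mulmxE mulmxA => r0.
apply: (step z); first by apply: eig_s; rewrite mem_head.
by apply: IHs r0 => y ys; apply: eig_s; rewrite in_cons ys orbT.
Qed.

Lemma is_eigE (R : realType) (m : nat) (M : 'M[R]_m) (lam : R[i]) :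
  is_eig M lam <-> eigenvalue (map_mx (real_complex R) M) lam.
Proof. by rewrite /is_eig eigenvalue_root_char map_char_poly. Qed.

(** Positivity of [r] is what lets [r / delta] serve later as a coupling gain. *)
Lemma is_eig_bound {R : realType} {q : nat} (S : 'M[R]_q) :
  exists2 r : R, 0 < r & forall lam : R[i], is_eig S lam -> complex.Re lam < r.
Proof.
have [s def_s] := closed_field_poly_normal (map_poly (real_complex R) (char_poly S)).
exists (1 + \sum_(z <- s) `|complex.Re z|) => [|lam].
  by rewrite ltr_pwDl // sumr_ge0.
have lc : lead_coef (map_poly (real_complex R) (char_poly S)) != 0.
  by rewrite lead_coef_eq0 map_char_poly monic_neq0 ?char_poly_monic.
rewrite /is_eig def_s rootZ // root_prod_XsubC => lam_s.
rewrite (big_rem lam) //= ltr_pwDl // (le_trans (ler_norm _)) //.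
by rewrite lerDl sumr_ge0.
Qed.

(** * Decay of Hurwitz linear systems *)

(** A Gronwall argument: once [h] is below [c * (e / 2)], any positive excess of [f] over [e / 2]
    decays at least like [expR (- (c * t))]. *)
Lemma decay_of_diff_ineq {R : realType} (f df h : R -> R) (c : R) :
  0 < c -> (forall t, 0 <= f t) -> (forall t : R, is_derive t (1 : R) f (df t)) ->
  (forall t, df t <= - c * f t + h t) ->
  (h t @[t --> +oo] --> (0 : R))%classic -> (f t @[t --> +oo] --> (0 : R))%classic.
Proof.
move=> c0 f0 fd fle h0; apply/cvgrPdist_le => e e0.
have ce0 : 0 < c * (e / 2) by rewrite mulr_gt0 ?divr_gt0.
move/cvgrPdist_le: h0 => /(_ _ ce0) [T [_ hT]].
have {}hT t : T < t -> h t <= c * (e / 2).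
  by move=> /hT; rewrite sub0r normrN => /(le_trans (ler_norm _)).
pose g t := (f t - e / 2) * expR (c * t).
have gd (t : R) : is_derive t (1 : R) g ((df t + c * (f t - e / 2)) * expR (c * t)).
  rewrite /g; apply: is_derive_eq; rewrite /GRing.scale /=; ring.
have gle t u : T < t -> t <= u -> g u <= g t.
  move=> Tt tu; have gc : {within `[t, u], continuous g}%classic.
    apply: derivable_within_continuous => y _; exact: (@ex_derive _ _ _ _ _ _ _ (gd y)).
  have [y] := MVT_segment tu (fun y _ => gd y) gc.
  rewrite in_itv /= => /andP[ty _] /eqP; rewrite subr_eq => /eqP ->.
  rewrite gerDr mulr_le0_ge0 ?subr_ge0 // mulr_le0_ge0 ?expR_ge0 //.
  have := fle y; have := hT y (lt_le_trans Tt ty); lra.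
(* [hT] holds only strictly beyond [T], so the estimate starts at [T + 1]. *)
pose K := g (T + 1); have K1 : 0 < `|K| + 1 by rewrite ltr_pwDr.
have T1 : T < T + 1 by rewrite ltrDl.
have fb t : T + 1 <= t -> f t <= e / 2 + `|K| * expR (- (c * t)).
  move=> /(gle _ _ T1); rewrite /g -/(g _) -/K => gK.
  rewrite -lerBlDl expRN ler_pdivlMr ?expR_gt0 //.
  exact: le_trans gK (ler_norm _).
have exp0 : (expR (- (c * t)) @[t --> +oo] --> (0 : R))%classic.
  apply: (cvg_comp (fun t : R => c * t) (fun t => expR (- t))); last exact: cvgr_expR.
  exact: gt0_cvgMry.
have eK : 0 < e / 2 / (`|K| + 1) by rewrite !divr_gt0.
move/cvgrPdist_le: exp0 => /(_ _ eK)[T' [_ hT']].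
near=> t.
rewrite sub0r normrN ger0_norm //.
have : expR (- (c * t)) <= e / 2 / (`|K| + 1).
  have : T' < t by near: t; apply: nbhs_pinfty_gt; exact: num_real.
  by move=> /hT'; rewrite sub0r normrN ger0_norm ?expR_ge0.
rewrite ler_pdivlMr // => hE.
have ft : f t <= e / 2 + `|K| * expR (- (c * t)).
  by apply: fb; near: t; apply: nbhs_pinfty_ge; exact: num_real.
have : 0 <= expR (- (c * t)) by exact: expR_ge0.
lra.
Unshelve. all: by end_near.
Qed.

(** These are the real and imaginary parts of [z' = (al + i be) z + (f + i g)] with [z = a + i b];
    the Lyapunov function is [|z|^2]. *)
Lemma decay_of_complex_ode {R : realType} (a b f g : R -> R) (al be : R) :
  al < 0 ->
  (forall t : R, is_derive t (1 : R) a (al * a t - be * b t + f t)) ->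
  (forall t : R, is_derive t (1 : R) b (be * a t + al * b t + g t)) ->
  (f t @[t --> +oo] --> (0 : R))%classic -> (g t @[t --> +oo] --> (0 : R))%classic ->
  (a t @[t --> +oo] --> (0 : R))%classic /\ (b t @[t --> +oo] --> (0 : R))%classic.
Proof.
move=> al0 da db f0 g0; pose E t := a t ^+ 2 + b t ^+ 2.
have E0 t : 0 <= E t by rewrite addr_ge0 ?sqr_ge0.
have dE (t : R) : is_derive t (1 : R) E
    (2 * (al * E t + (a t * f t + b t * g t))).
  have -> : E = (a ^+ 2 + b ^+ 2)%R by apply/funext => u; rewrite /E !fctE.
  apply: is_derive_eq; rewrite /GRing.scale /= !fctE.
  by rewrite /E !expr1; ring.
have cvgE : (E t @[t --> +oo] --> (0 : R))%classic.
  have nal0 : 0 < - al by rewrite oppr_gt0.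
  apply: (decay_of_diff_ineq E _ (fun t => (- al)^-1 * (f t * f t + g t * g t)) (- al) nal0 E0 dE).
    move=> t; rewrite /E -subr_ge0.
    (* Young's inequality with its remainder written as a sum of squares: half of the dissipation
       absorbs the cross terms. *)
    have -> : - - al * (a t ^+ 2 + b t ^+ 2) + (- al)^-1 * (f t * f t + g t * g t)
       - 2 * (al * (a t ^+ 2 + b t ^+ 2) + (a t * f t + b t * g t))
       = (- al)^-1 * ((al * a t + f t) ^+ 2 + (al * b t + g t) ^+ 2).
      field; lra.
    by rewrite mulr_ge0 ?invr_ge0 ?addr_ge0 ?sqr_ge0 // ltW.
  have -> : (0 : R) = (- al)^-1 * (0 * 0 + 0 * 0) by rewrite mulr0 addr0 mulr0.
  apply: cvgMr; apply: cvgD; exact: cvgM.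
have le_cvg h : (forall t, `|h t| ^+ 2 <= E t) -> (h t @[t --> +oo] --> (0 : R))%classic.
  move=> hE; apply/cvgrPdist_lt => e e0.
  have e20 : 0 < e ^+ 2 by rewrite exprn_gt0.
  move/cvgrPdist_lt: cvgE => /(_ _ e20); apply: filterS => t.
  rewrite sub0r normrN sub0r normrN ger0_norm // => /(le_lt_trans (hE t)).
  by rewrite ltr_pXn2r // ?nnegrE // ltW.
by split; apply: le_cvg => t; rewrite real_normK ?num_real // /E ?lerDl ?lerDr sqr_ge0.
Qed.

Lemma is_derive_coord {R : realType} {m n : nat} (M : R -> 'M[R]_(m, n)) (t : R) (dM : 'M[R]_(m, n)) i j :
  is_derive t (1 : R) M dM -> is_derive t (1 : R) (fun s => M s i j) (dM i j).
Proof.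
case=> Md <-; apply: DeriveDef; first exact: (derivable_mxP _ _ _).1.
by rewrite derive_mx // mxE.
Qed.

Lemma is_derive_mulmx_coord {R : realType} {m n : nat} (r : 'M[R]_(m, n)) (z : R -> 'cV[R]_n)
    (t : R) (dz : 'cV[R]_n) i :
  (forall k, is_derive t (1 : R) (fun s => z s k 0) (dz k 0)) ->
  is_derive t (1 : R) (fun s => (r *m z s) i 0) ((r *m dz) i 0).
Proof.
move=> zd.
have -> : (fun s => (r *m z s) i 0) = \sum_(k < n) (r i k \*: (fun s => z s k 0)).
  by apply/funext => s; rewrite mxE fct_sumE.
have -> : (r *m dz) i 0 = \sum_(k < n) r i k *: dz k 0 by rewrite mxE.
by apply: is_derive_sum => k; apply: is_deriveZ.
Qed.

(** For a complex row [r], the function [y = r z] satisfies [y' = s y + r (M - s) z]. If [s] is in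
    the spectrum and the forcing term decays, so does [y]; spectral induction then reaches every
    row, in particular the unit rows. *)
Lemma hurwitz_decay {R : realType} {n : nat} (M : 'M[R]_n) (z : R -> 'cV[R]_n) :
  hurwitz M ->
  (forall (t : R) k, is_derive t (1 : R) (fun s => z s k 0) ((M *m z t) k 0)) ->
  forall k, (z t k 0 @[t --> +oo] --> (0 : R))%classic.
Proof.
move=> hM zd k.
pose re (r : 'rV[R[i]]_n) : 'rV[R]_n := map_mx (@complex.Re R) r.
pose im (r : 'rV[R[i]]_n) : 'rV[R]_n := map_mx (@complex.Im R) r.
pose P r := ((re r *m z t) 0 0 @[t --> +oo] --> (0 : R))%classic /\
            ((im r *m z t) 0 0 @[t --> +oo] --> (0 : R))%classic.
have P0 : P 0.
  have re0 : re 0 = 0 by apply/rowP => l; rewrite !mxE.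
  have im0 : im 0 = 0 by apply/rowP => l; rewrite !mxE.
  split; rewrite ?re0 ?im0; under eq_fun do rewrite mul0mx mxE; exact: cvg_cst.
have allP : forall r, P r.
  apply: (row_eigen_ind (map_mx (real_complex R) M)) P0 _ => s r /is_eigE/hM s0.
  (* [reM] and [imM] split [r (M - s)] into real and imaginary parts, to match the forcing terms of
     [decay_of_complex_ode]. *)
  have reM : re (r *m (map_mx (real_complex R) M - s%:M)) =
      re r *m M - (complex.Re s *: re r - complex.Im s *: im r).
    apply/rowP => l; rewrite mulmxBr mul_mx_scalar !mxE raddfB /= raddf_sum /=.
    congr (_ - _); last by case: (s) => a b; case: (r 0 l).
    by apply: eq_bigr => j _; rewrite !mxE; case: (r 0 j) => a b /=; rewrite mulr0 subr0.
  have imM : im (r *m (map_mx (real_complex R) M - s%:M)) =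
      im r *m M - (complex.Re s *: im r + complex.Im s *: re r).
    apply/rowP => l; rewrite mulmxBr mul_mx_scalar !mxE raddfB /= raddf_sum /=.
    congr (_ - _); last by case: (s) => a b; case: (r 0 l).
    by apply: eq_bigr => j _; rewrite !mxE; case: (r 0 j) => a b /=; rewrite mulr0 add0r.
  case; rewrite reM imM => f0 g0.
  apply: (decay_of_complex_ode _ _ _ _ (complex.Re s) (complex.Im s) s0 _ _ f0 g0) => t.
    apply: is_derive_eq; first exact: is_derive_mulmx_coord.
    rewrite !mulmxBl -!scalemxAl mulmxA.
    by move: (_ *m z t) (re r *m z t) (im r *m z t) => u v w; rewrite !mxE; ring.
  apply: is_derive_eq; first exact: is_derive_mulmx_coord.
  rewrite mulmxBl mulmxDl -!scalemxAl mulmxA.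
  by move: (_ *m z t) (re r *m z t) (im r *m z t) => u v w; rewrite !mxE; ring.
have [+ _] := allP (delta_mx 0 k).
have -> : re (delta_mx 0 k) = delta_mx 0 k.
  by apply/rowP => l; rewrite !mxE; case: (_ && _).
by under eq_fun do rewrite -rowE mxE.
Qed.

Lemma cvg_mulmx_coord0 {R : realType} {m n : nat} (G : 'M[R]_(m, n)) (y : R -> 'cV[R]_n) i :
  (forall k, (y t k 0 @[t --> +oo] --> (0 : R))%classic) ->
  ((G *m y t) i 0 @[t --> +oo] --> (0 : R))%classic.
Proof.
move=> y0; under eq_fun do rewrite mxE.
elim: (index_enum _) => [|k r IHr].
  by under eq_fun do rewrite big_nil; exact: cvg_cst.
under eq_fun do rewrite big_cons.
have : (G i k * y t k 0 @[t --> +oo] --> G i k * 0)%classic by exact: cvgMr.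
by rewrite mulr0 => /cvgD/(_ IHr); rewrite addr0.
Qed.

Lemma cvg_mx_coord0 {R : realType} {m n : nat} (M : R -> 'M[R]_(m, n)) :
  (forall i j, (M t i j @[t --> +oo] --> (0 : R))%classic) ->
  (M t @[t --> +oo] --> (0 : 'M[R]_(m, n)))%classic.
Proof.
move=> M0; apply/cvgrPdist_le => e e0.
have : \forall t \near +oo%R, forall ij : 'I_m * 'I_n, `|M t ij.1 ij.2| <= e.
  apply: filter_forall => -[i j] /=.
  by move/cvgrPdist_le: (M0 i j) => /(_ e e0); apply: filterS => t; rewrite sub0r normrN.
apply: filterS => t Mt; rewrite sub0r normrN [leLHS]/Num.Def.normr/= mx_normrE.
by apply: bigmax_le => [|ij _]; [exact: ltW | exact: Mt].
Qed.

(** * Regulator equations *)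

(** Turns the trace pairing into a dot product of vectorized matrices, for which the adjoint of a
    linear map is the transpose of its [lin_mx]. *)
Lemma mxtrace_mulmx {F : comPzSemiRingType} {n m : nat} (A : 'M[F]_(n, m)) (B : 'M[F]_(m, n)) :
  \tr (A *m B) = (mxvec A *m (mxvec B^T)^T) 0 0.
Proof.
rewrite mxE (reindex _ (curry_mxvec_bij _ _)) /= /mxtrace.
rewrite (eq_bigr (fun i => \sum_j A i j * B j i)) => [|i _]; last by rewrite mxE.
rewrite (pair_big xpredT xpredT (fun i j => A i j * B j i)).
by apply: eq_bigr => -[i j] _ /=; rewrite [in RHS]mxE !mxvecE mxE.
Qed.

(* The hypothesis is injectivity of the adjoint map for the pairing [(Y, W) |-> \tr (Y *m W)]. *)
Lemma sylvester_image {F : fieldType} {n p q : nat} (S : 'M[F]_q) (J G : 'M[F]_(p, n)) :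
  (forall W : 'M[F]_(q, p), S *m W *m J = W *m G -> W = 0) ->
  forall Y : 'M[F]_(p, q), exists Z : 'M[F]_(n, q), J *m Z *m S - G *m Z = Y.
Proof.
move=> inj Y; pose L (Z : 'M[F]_(n, q)) := J *m Z *m S - G *m Z.
have Llin : linear L.
  move=> a Z1 Z2; rewrite /L !mulmxDr !mulmxDl -!scalemxAr -scalemxAl.
  by rewrite opprD addrACA scalerBr.
pose Ll := GRing.isLinear.Build _ _ _ _ L Llin.
pose L' : {linear 'M[F]_(n, q) -> 'M[F]_(p, q)} := HB.pack L Ll.
(* Surjectivity amounts to a trivial left kernel of the transpose; a row [r] of that kernel unfolds
   into a [W] orthogonal to the image of [L]. *)
have full : row_full (lin_mx L').
  rewrite /row_full -mxrank_tr -/(row_free _) -kermx_eq0.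
  apply/eqP/row_matrixP => i; rewrite row0; set r := row i _.
  have r0 : r *m (lin_mx L')^T = 0 by apply/sub_kermxP/row_sub.
  pose W : 'M[F]_(q, p) := (vec_mx r)^T.
  have LW0 Z : \tr (L Z *m W) = 0.
    rewrite mxtrace_mulmx trmxK vec_mxK -[mxvec (L Z)](mul_vec_lin L') -mulmxA.
    by rewrite -[lin_mx L' *m _]trmxK trmx_mul trmxK r0 trmx0 mulmx0 mxE.
  have /inj W0 : S *m W *m J = W *m G.
    apply/eqP; rewrite -subr_eq0; apply/eqP/matrixP => i1 i2; rewrite [RHS]mxE.
    (* Testing against a matrix unit reads off one entry of [S *m W *m J - W *m G]. *)
    rewrite -(LW0 (delta_mx i2 i1)) /L mulmxBl raddfB /= -!mulmxA.
    rewrite [\tr (J *m _)]mxtrace_mulC [\tr (G *m _)]mxtrace_mulC -!mulmxA.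
    rewrite -raddfB /= -mulmxBr; set T := _ - _.
    rewrite mxtrace_mulC /mxtrace (bigD1 i1) //= big1 ?addr0 => [|k ki1]; last first.
      rewrite mxE big1 // => l _.
      by rewrite [X in _ * X]mxE (negPf ki1) andbF mulr0.
    rewrite [RHS]mxE (bigD1 i2) //= big1 ?addr0 => [|l li2].
      by rewrite [X in _ * X]mxE !eqxx mulr1 /T !mulmxA.
    by rewrite [X in _ * X]mxE (negPf li2) mulr0.
  by rewrite -[r]vec_mxK -[vec_mx r]trmxK -/W W0 trmx0 linear0.
have /submxP [D DE] : (mxvec Y <= lin_mx L')%MS by rewrite submx_full.
exists (vec_mx D); apply: (can_inj mxvecK); rewrite DE.
by rewrite -[mxvec _](mul_vec_lin L') vec_mxK.
Qed.

(** With [Z] the stack of [Pi] over [Gam] and [G] the system matrix, both equations become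
    [J Z S - G Z = col_mx E F], so [sylvester_image] reduces solvability to an injectivity. *)
Lemma regulator_equations {R : realType} {n m p q : nat} (S : 'M[R]_q)
    (A : 'M[R]_n) (B : 'M[R]_(n, m)) (C : 'M[R]_(p, n)) (D : 'M[R]_(p, m))
    (E : 'M[R]_(n, q)) (F : 'M[R]_(p, q)) :
  (forall lam : R[i], is_eig S lam ->
     row_free (map_mx (real_complex R) (block_mx A B C D) -
               lam *: map_mx (real_complex R) (block_mx 1%:M 0 0 0 : 'M[R]_(n + p, n + m)))) ->
  exists (Pi : 'M[R]_(n, q)) (Gam : 'M[R]_(m, q)),
    Pi *m S = A *m Pi + B *m Gam + E /\ C *m Pi + D *m Gam + F = 0.
Proof.
move=> tz; pose J : 'M[R]_(n + p, n + m) := block_mx 1%:M 0 0 0.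
have [W|Z] := sylvester_image S J (block_mx A B C D) _ (col_mx E F).
  move=> SWJ; have /matrixP : map_mx (real_complex R) W = 0.
    apply/row_matrixP => i; rewrite rowE row0.
    (* From [S W J = W G] follows [r W (G - s J) = r (S - s) W J]. The right side vanishes by
       induction, and the pencil [G - s J] is row free. *)
    apply: (row_eigen_ind (map_mx (real_complex R) S)
              (fun r => r *m map_mx (real_complex R) W = 0)) => [|s r s_eig rW].
      by rewrite mul0mx.
    apply: (row_free_inj (tz s _)); first exact/is_eigE.
    rewrite mul0mx mulmxBr -(mulmxA r) -map_mxM -SWJ !map_mxM -scalemxAr !mulmxA.
    by rewrite -/J !scalemxAl -2!mulmxBl -mul_mx_scalar -mulmxBr rW mul0mx.
  by move=> W0; apply/matrixP => i j; have := W0 i j; rewrite !mxE => /complexI.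
rewrite -[Z]vsubmxK /J !mul_block_col mul1mx !mul0mx !addr0 mul_col_mx mul0mx.
rewrite opp_col_mx add_col_mx => /eq_col_mx[eqE eqF].
exists (usubmx Z), (dsubmx Z); rewrite -eqE -eqF; split; first by rewrite addrC subrK.
by rewrite sub0r subrr.
Qed.

(** The data matrix is the pencil times [col_mx X U], so the pencil has at least its rank, which is
    already the number of rows. *)
Lemma data_transmission_zero {R : realType} {n m p q d : nat}
    (Dd : 'M[R]_d.+1) (V : 'M[R]_(q, d.+1)) (E : 'M[R]_(n, q)) (F : 'M[R]_(p, q))
    (X : 'M[R]_(n, d.+1)) (U : 'M[R]_(m, d.+1)) (Ecal : 'M[R]_(p, d.+1))
    (A : 'M[R]_n) (B : 'M[R]_(n, m)) (C : 'M[R]_(p, n)) (D : 'M[R]_(p, m)) (lam : R[i]) :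
  consistent Dd V E F X U Ecal A B C D ->
  \rank (map_mx (real_complex R) (col_mx (X *m Dd - E *m V) (Ecal - F *m V))
                 - col_mx (lam *: map_mx (real_complex R) X) 0) = (n + p)%N ->
  row_free (map_mx (real_complex R) (block_mx A B C D) -
    lam *: map_mx (real_complex R) (block_mx 1%:M 0 0 0 : 'M[R]_(n + p, n + m))).
Proof.
move=> [dX dE] rk; rewrite -row_leq_rank -{1}rk.
suff -> : map_mx (real_complex R) (col_mx (X *m Dd - E *m V) (Ecal - F *m V))
    - col_mx (lam *: map_mx (real_complex R) X) 0 =
    (map_mx (real_complex R) (block_mx A B C D) -
    lam *: map_mx (real_complex R) (block_mx 1%:M 0 0 0 : 'M[R]_(n + p, n + m)))
      *m map_mx (real_complex R) (col_mx X U).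
  exact: mxrankM_maxl.
rewrite mulmxBl -scalemxAl -!map_mxM !mul_block_col mul1mx !mul0mx !addr0 dX dE !addrK.
by rewrite [map_mx _ (col_mx X 0)]map_col_mx map_mx0 scale_col_mx scaler0.
Qed.

(** * The grounded Laplacian *)

(** [k x] is the length of a shortest path from [x0], and [y] is the vertex before [x] on such a
    path. *)
Lemma connect_rank {T : finType} (e : rel T) (x0 : T) :
  (forall x, connect e x0 x) ->
  exists k : T -> nat,
    [/\ k x0 = 0%N, forall x, (k x < #|T|)%N &
        forall x, x != x0 -> exists2 y, e y x & (k y < k x)%N].
Proof.
move=> conn.
pose len x n := [exists s : n.-tuple T, path e x0 s && (last x0 s == x)].
have lenP x s : path e x0 s -> last x0 s = x -> len x (size s).
  by move=> es sx; apply/existsP; exists (in_tuple s); rewrite es sx eqxx.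
have ex x : exists n, len x n.
  by have /connectP[s es ->] := conn x; exists (size s); exact: lenP.
exists (fun x => ex_minn (ex x)); split.
- by case: ex_minnP => n _ /(_ 0%N (lenP x0 [::] isT erefl)); rewrite leqn0 => /eqP.
- move=> x; case: ex_minnP => n _ nmin.
  have /connectP[s es sx] := conn x.
  (* A path without repetition has fewer edges than there are vertices. *)
  case/shortenP: es sx => s' es' us' _ sx.
  apply: leq_ltn_trans (nmin _ (lenP x s' es' (esym sx))) _.
  by have := max_card (mem (x0 :: s')); rewrite (card_uniqP us').
- move=> x xx0; case: ex_minnP => n /existsP[s /andP[es /eqP sx]] nmin.
  case/lastP: {s}(val s) (size_tuple s) es sx => [_ _ /= x0x|s y].
    by rewrite x0x eqxx in xx0.
  rewrite size_rcons last_rcons rcons_path => sn /andP[es ey] yx; subst y.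
  exists (last x0 s) => //; case: ex_minnP => n' _ /(_ _ (lenP _ _ es erefl)).
  by rewrite -sn ltnS.
Qed.

(* [w i := 1 - th ^+ k i], with [k i] the distance from the leader: the edge from a parent
   contributes at least [eps1 * th ^+ (k i - 1) * (1 - th)], all the others together lose at most
   [eps2 * th ^+ k i]. *)
Lemma admissible_graph_weights {R : realType} (N : nat) (eps1 eps2 : R) :
  0 < eps1 -> eps1 <= eps2 ->
  exists2 delta : R, 0 < delta & forall (a : 'M[R]_N) (a0 : 'cV[R]_N),
    admissible_graph eps1 eps2 a a0 ->
    exists w : 'I_N -> R, forall i, 0 < w i <= 1 /\
      delta <= (\sum_k a i k + a0 i 0) * w i - \sum_j a i j * w j.
Proof.
move=> e1 e12; have e2 : 0 < eps2 by apply: lt_le_trans e12.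
(* In units of [eps1 * th ^+ (k i - 1)], the parent now gains at least 3/4 and the other edges lose
   at most 1/4; the remaining 1/2 gives [delta], since [k i <= N]. *)
pose th := eps1 / (4 * eps2).
have th0 : 0 < th by rewrite divr_gt0 // mulr_gt0.
have thE : eps2 * th = eps1 / 4 by rewrite /th; field; lra.
have th4 : th <= 1 / 4 by rewrite /th ler_pdivrMr ?mulr_gt0 //; lra.
have th1 : th <= 1 by lra.
exists (th ^+ N * eps1 / 2) => [|a a0 [a_ge0 a0_ge0 adiag conn epsL]].
  by rewrite divr_gt0 // mulr_gt0 // exprn_gt0.
have [k [k0 kN kpar]] := connect_rank _ _ conn.
pose d r := 1 - th ^+ k r.
have dlt1 r : d r <= 1 by rewrite /d lerBlDr lerDl exprn_ge0 //; lra.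
pose g r c := aug_adj a a0 r c.
have g_ge0 r c : 0 <= g r c.
  by rewrite /g mxE; case: (unlift ord0 r) => [i|//]; case: (unlift ord0 c).
have key r : r != ord0 -> 0 < d r /\
    th ^+ N * eps1 / 2 <= \sum_c g r c * (d r - d c).
  move=> r0; have [c0 ec kc] := kpar r r0.
  have gc0 : 0 < g r c0 by rewrite lt0r g_ge0 andbT.
  have ltkr : (0 < k r)%N by apply: leq_ltn_trans kc.
  have [kr krE] : exists kr, k r = kr.+1 by exists (k r).-1; rewrite prednK.
  have krN : (kr <= N)%N by have := kN r; rewrite krE card_ord ltnS => /ltnW.
  (* The Laplacian bounds serve twice: off the diagonal they bound the parent's weight below by
     [eps1], on the diagonal they bound the whole row sum above by [eps2]. *)
  have off i j : i != j -> aug_laplacian a a0 i j = - g i j.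
    move=> ij; rewrite /aug_laplacian mxE [X in X + _]mxE (negPf ij) mulr0n.
    by rewrite [X in _ + X]mxE sub0r.
  have rc0 : r != c0 by apply: contraTneq kc => ->; rewrite ltnn.
  have grr : g r r = 0.
    by rewrite /g mxE; case: (unlift ord0 r) => [i|//]; exact: adiag.
  have Lrr : aug_laplacian a a0 r r = \sum_c g r c.
    rewrite /aug_laplacian mxE [X in X + _]mxE eqxx mulr1n [X in X + _]mxE.
    by rewrite [X in _ + X]mxE -/(g r r) grr subr0.
  have gc_ge : eps1 <= g r c0.
    have := epsL r c0; rewrite off // oppr_eq0 normrN gt_eqF // ger0_norm //.
    by case/(_ isT)/andP.
  have sum_le : \sum_c g r c <= eps2.
    have sgt0 : 0 < \sum_c g r c by rewrite (bigD1 c0) //= ltr_wpDr // sumr_ge0.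
    have := epsL r r; rewrite Lrr gt_eqF // ger0_norm ?(ltW sgt0) //.
    by case/(_ isT)/andP.
  split.
    rewrite /d krE exprS subr_gt0.
    apply: le_lt_trans (_ : th * 1 < 1); last by lra.
    by rewrite ler_wpM2l ?exprn_ile1 //; lra.
  have thkr : th ^+ N <= th ^+ kr by rewrite ler_wiXn2l ?(ltW th0).
  have dc0 : th ^+ kr * (1 - th) <= d r - d c0.
    have : th ^+ kr <= th ^+ k c0 by rewrite ler_wiXn2l ?(ltW th0) // -ltnS -krE.
    by rewrite /d krE exprS; lra.
  (* No node has weight above 1, so this holds whatever the distance of [c]. *)
  have dc c : - (th * th ^+ kr) <= d r - d c.
    by have := dlt1 c; rewrite [d r]/d krE exprS; lra.
  have kr0 : 0 < th ^+ kr by rewrite exprn_gt0.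
  rewrite (bigD1 c0) //=.
  have rest : - (eps2 * (th * th ^+ kr)) <= \sum_(c | c != c0) g r c * (d r - d c).
    apply: le_trans (_ : - ((\sum_(c | c != c0) g r c) * (th * th ^+ kr)) <= _).
      rewrite lerN2 ler_wpM2r ?(ltW (mulr_gt0 th0 kr0)) //; apply: le_trans sum_le.
      by rewrite [leRHS](bigD1 c0) //= lerDr.
    rewrite -mulrN mulr_suml; apply: ler_sum => c _.
    by rewrite ler_wpM2l.
  have first : eps1 * (th ^+ kr * (1 - th)) <= g r c0 * (d r - d c0).
    apply: le_trans (_ : g r c0 * (th ^+ kr * (1 - th)) <= _); last by rewrite ler_wpM2l.
    by rewrite ler_wpM2r // mulr_ge0 ?(ltW kr0) // subr_ge0.
  have e2th : eps2 * (th * th ^+ kr) = eps1 / 4 * th ^+ kr by rewrite mulrA thE.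
  have : eps1 * th ^+ N <= eps1 * th ^+ kr by rewrite ler_wpM2l // ltW.
  have : 0 <= eps1 * th ^+ kr * (1 / 4 - th) by rewrite !mulr_ge0 ?(ltW e1) ?(ltW kr0) // subr_ge0.
  lra.
exists (fun i => d (lift ord0 i)) => i.
have [//|d0 sum_ge] := key (lift ord0 i).
split; first by rewrite d0 dlt1.
(* The leader has distance 0, hence weight 0: its column yields exactly the [a0 i 0] term. *)
apply: le_trans sum_ge _; rewrite big_ord_recl /=.
rewrite /g mxE liftK unlift_none /d k0 expr0 subrr subr0 -/(d _).
under eq_bigr => j _ do rewrite mxE !liftK mulrBr.
rewrite sumrB -mulr_suml; lra.
Qed.

(** This is the block of [aug_laplacian a a0] on the followers: the Laplacian with the leader
    grounded. *)
Definition follower_laplacian {R : realType} {N : nat} (a : 'M[R]_N) (a0 : 'cV[R]_N) : 'M[R]_N :=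
  \matrix_(i, j) ((i == j)%:R * (\sum_k a i k + a0 i 0) - a i j).

(* Gershgorin's theorem after conjugation by diag(w). *)
Lemma follower_laplacian_eig {R : realType} {N : nat} (delta : R) (a : 'M[R]_N) (a0 : 'cV[R]_N)
    (w : 'I_N -> R) :
  (forall i j, 0 <= a i j) -> (forall i, a i i = 0) ->
  (forall i, 0 < w i <= 1 /\
      delta <= (\sum_k a i k + a0 i 0) * w i - \sum_j a i j * w j) ->
  0 < delta ->
  forall xi : R[i], is_eig (follower_laplacian a a0)^T xi -> delta <= complex.Re xi.
Proof.
move=> a_ge0 adiag wP delta0 xi /is_eigE /eigenvalueP[v vH v0].
pose h i := \sum_k a i k + a0 i 0.
pose y i := v 0 i.
have yE i : \sum_j (a i j)%:C%C * y j = ((h i)%:C%C - xi) * y i.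
  move/rowP: vH => /(_ i); rewrite !mxE mulrBl => <-; rewrite -/(y i).
  have -> : \sum_j v 0 j * map_mx (real_complex R) (follower_laplacian a a0)^T j i =
      (h i)%:C%C * y i - \sum_j (a i j)%:C%C * y j; last by rewrite subKr.
  rewrite (eq_bigr (fun j => (h i)%:C%C * ((i == j)%:R * y j) - (a i j)%:C%C * y j)).
    rewrite sumrB -mulr_sumr (bigD1 i) //= eqxx mul1r big1 ?addr0 // => j ji.
    by rewrite eq_sym (negPf ji) mul0r.
  by move=> j _; rewrite !mxE -/(h i) rmorphB rmorphM rmorph_nat /y; ring.
have w_gt0 i : 0 < w i by case: (wP i) => /andP[].
have [i0 yi0] : exists i, y i != 0.
  apply/existsP; apply: contraNT v0 => /existsPn H; apply/eqP/rowP => i.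
  by rewrite mxE; apply/eqP; rewrite -[_ == _]negbK H.
pose nrm i := complex.Re `|y i|.
have nrmE i : `|y i| = (nrm i)%:C%C by rewrite RRe_real // normr_real.
have nrm_ge0 i : 0 <= nrm i by rewrite -ler0c -nrmE.
(* The Gershgorin row: the entry of largest modulus after rescaling by [w]. *)
have [i _ imax] := @arg_maxP _ R 'I_N i0 xpredT (fun i => nrm i / w i) isT.
have n0 : 0 < nrm i.
  have : 0 < nrm i0 / w i0 by rewrite divr_gt0 // -ltcR -nrmE normr_gt0.
  move=> /lt_le_trans/(_ (imax i0 isT)); rewrite ltr_pdivlMr ?mul0r //.
have le_j j : nrm j <= nrm i / w i * w j.
  by rewrite -ler_pdivrMr //; exact: imax.
(* The disc with centre [h i] and radius [h i - delta] has [delta] as its leftmost point. *)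
have cplx : `|(h i)%:C%C - xi| <= (h i - delta)%:C%C.
  rewrite -(ler_pM2r (_ : 0 < `|y i|)); last by rewrite nrmE ltcR.
  rewrite -normrM -yE; apply: le_trans (ler_norm_sum _ _ _) _.
  under eq_bigr => j _ do
    rewrite normrM ger0_norm ?ler0c // nrmE -rmorphM.
  rewrite -rmorph_sum nrmE -rmorphM lecR.
  apply: le_trans (_ : nrm i / w i * \sum_j a i j * w j <= _).
    rewrite mulr_sumr; apply: ler_sum => j _.
    by rewrite mulrCA ler_wpM2l // -mulrC; have := le_j j.
  rewrite mulrAC ler_pdivrMr // -mulrA [leRHS]mulrCA ler_pM2l //.
  (* [w i <= 1] weakens the margin [delta] to [delta * w i], from which [w i] can be factored
     out. *)
  case: (wP i) => /andP[_ w1] dle.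
  have : delta * w i <= delta by rewrite ler_piMr // ltW.
  rewrite -/(h i) in dle; lra.
have : `|complex.Re ((h i)%:C%C - xi)|%:C%C <= (h i - delta)%:C%C :> R[i].
  exact: le_trans (normc_ge_Re _) cplx.
rewrite lecR raddfB /= => /(le_trans (ler_norm _)); lra.
Qed.

(** * The closed loop *)

Lemma map_mxblock {T1 T2 : Type} (f : T1 -> T2) {m n : nat} {p_ : 'I_m -> nat} {q_ : 'I_n -> nat}
    (B : forall i j, 'M[T1]_(p_ i, q_ j)) :
  map_mx f (\mxblock_(i, j) B i j) = \mxblock_(i, j) map_mx f (B i j).
Proof. by apply/matrixP => i j; rewrite !mxE. Qed.

Lemma map_mxdiag {T1 T2 : nzRingType} (f : {rmorphism T1 -> T2}) {m : nat} {p_ : 'I_m -> nat}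
    (B : forall i, 'M[T1]_(p_ i)) :
  map_mx f (\mxdiag_i B i) = \mxdiag_i map_mx f (B i).
Proof.
rewrite /mxdiag map_mxblock; apply/eq_mxblockP => i j.
by case: (eqVneq i j) => [<-|_]; rewrite ?conform_mx_id ?map_mx0.
Qed.

(** By block triangularity, a left eigenvector for an eigenvalue with nonnegative real part first
    loses its follower part [u], which decouples the observer part [w]. *)
Lemma closed_loop_hurwitz {R : realType} {N : nat} {n m : 'I_N -> nat} {q : nat}
    (A : forall i, 'M[R]_(n i)) (B : forall i, 'M[R]_(n i, m i))
    (K1 : forall i, 'M[R]_(m i, n i)) (K2 : forall i, 'M[R]_(m i, q))
    (S : 'M[R]_q) (mu : R) (a : 'M[R]_N) (a0 : 'cV[R]_N) :
  (forall i, hurwitz (A i + B i *m K1 i)) ->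
  (forall i, a i i = 0) ->
  (forall sig xi : R[i], is_eig S sig -> is_eig (follower_laplacian a a0)^T xi ->
     complex.Re sig < mu * complex.Re xi) ->
  hurwitz (closed_loop A B K1 K2 S mu a a0).
Proof.
move=> hA adiag hmu lam /is_eigE /eigenvalueP[v]; rewrite ltNge => vM v0.
apply: contraNN v0 => lam0.
move: vM; rewrite -[v]hsubmxK; set u := lsubmx v; set w := rsubmx v.
rewrite map_block_mx mul_row_block map_mx0 mulmx0 addr0 scale_row_mx => /eq_row_mx[uE wE].
have u0 : u = 0.
  rewrite -[u]submxrowK -(@mxrow0 _ _ n); congr mxrow.
  apply: functional_extensionality_dep => i; apply/eqP; apply: contraTT lam0 => ui0.
  rewrite -ltNge; apply: (hA i); apply/is_eigE/eigenvalueP; exists (submxrow u i) => //.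
  have := congr1 (fun M => submxrow M i) uE.
  rewrite map_mxdiag -{1}[u]submxrowK mul_mxrow_mxdiag mxrowK => ->.
  by apply/matrixP => k l; rewrite !mxE.
have row_w j : \sum_i submxrow w i *m map_mx (real_complex R)
    (if i == j then S - (mu * (\sum_k a i k + a0 i 0)) *: 1%:M else (mu * a i j) *: 1%:M)
    = lam *: submxrow w j.
  have := congr1 (fun M => submxrow M j) wE.
  rewrite u0 mul0mx add0r map_mxblock -{1}[w]submxrowK mul_mxrow_mxblock mxrowK => ->.
  by apply/matrixP => k l; rewrite !mxE.
(* With the blocks of [w] as rows of [Om], the observer block acts as [Om S - mu H^T Om]. *)
pose Om : 'M[R[i]]_(N, q) := \matrix_(i, k) submxrow w i 0 k.
pose Hc := map_mx (real_complex R) (follower_laplacian a a0)^T.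
pose Sc := map_mx (real_complex R) S.
have OmE : Om *m Sc = (lam *: 1%:M + mu%:C%C *: Hc) *m Om.
  have rowOm j : row j Om = submxrow w j by apply/rowP => k; rewrite !mxE.
  apply/row_matrixP => j; rewrite mulmxDl -!scalemxAl mul1mx linearD !linearZ /= !row_mul.
  rewrite rowOm -row_w -rowOm [row j Hc *m _]mulmx_sum_row scaler_sumr -big_split /=.
  rewrite (eq_bigr (fun i => if i == j then row i Om *m Sc else 0)).
    by rewrite -big_mkcond big_pred1_eq.
  move=> i _; rewrite -rowOm scalerA !mxE.
  case: eqVneq => [->|ij].
    rewrite adiag subr0 mul1r map_mxB map_mxZ map_mx1 mulmxBr -scalemxAr mulmx1.
    by rewrite -rmorphM subrK.
  rewrite mul0r sub0r map_mxZ map_mx1 -scalemxAr mulmx1.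
  by rewrite -rmorphM mulrN rmorphN scaleNr subrr.
(* If [r (Hc - xi)] kills [Om], then [r *m Om] is zero or a left eigenvector of [S] for
   [lam + mu xi]; by [hmu] the latter would make the real part of [lam] negative. *)
have rOm : forall r : 'rV_N, r *m Om = 0.
  apply: (row_eigen_ind Hc); first by rewrite mul0mx.
  move=> xi r xi_eig r0; apply/eqP; apply/negPn/negP => rO.
  have rH : r *m Hc *m Om = xi *: (r *m Om).
    move: r0; rewrite mulmxBr mulmxBl mul_mx_scalar -scalemxAl => /eqP.
    by rewrite subr_eq0 => /eqP.
  have xi_eig' : is_eig (follower_laplacian a a0)^T xi by apply/is_eigE; exact: xi_eig.
  have /is_eigE/hmu/(_ xi_eig') : eigenvalue Sc (lam + mu%:C%C * xi).
    apply/eigenvalueP; exists (r *m Om) => //.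
    rewrite -mulmxA OmE mulmxA mulmxDr -!scalemxAr mulmx1 mulmxDl -!scalemxAl rH.
    by rewrite scalerA scalerDl.
  have -> : complex.Re (lam + mu%:C%C * xi) = complex.Re lam + mu * complex.Re xi.
    by case: (lam) (xi) => b c [b' c'] /=; rewrite mul0r subr0.
  by apply/negP; rewrite -leNgt lerDr.
have Om0 : Om = 0 by apply/row_matrixP => i; rewrite rowE rOm row0.
have w0 : w = 0.
  rewrite -[w]submxrowK -(@mxrow0 _ _ (fun=> q)); congr mxrow.
  apply/funext => i; apply/rowP => k.
  by move/matrixP: Om0 => /(_ i k); rewrite !mxE.
by rewrite u0 w0 row_mx0.
Qed.

(** [K1 i *m Pi i + K2 i] stands for [Gam i]: the two equations on [Pi] say that [x_i = Pi_i v],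
    [eta_i = v] is a motion with zero error, and the closed-loop matrix governs the deviation from
    it. *)
Lemma hurwitz_output_regulated {R : realType} {N : nat} {n m : 'I_N -> nat} {p q : nat}
    (A : forall i, 'M[R]_(n i)) (B : forall i, 'M[R]_(n i, m i))
    (C : forall i, 'M[R]_(p, n i)) (D : forall i, 'M[R]_(p, m i))
    (E : forall i, 'M[R]_(n i, q)) (F : forall i : 'I_N, 'M[R]_(p, q))
    (K1 : forall i, 'M[R]_(m i, n i)) (K2 : forall i, 'M[R]_(m i, q))
    (S : 'M[R]_q) (mu : R) (a : 'M[R]_N) (a0 : 'cV[R]_N)
    (Pi : forall i, 'M[R]_(n i, q)) :
  (forall i : 'I_N, a i i = 0) ->
  (forall i : 'I_N, Pi i *m S = A i *m Pi i + B i *m (K1 i *m Pi i + K2 i) + E i) ->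
  (forall i : 'I_N, C i *m Pi i + D i *m (K1 i *m Pi i + K2 i) + F i = 0) ->
  hurwitz (closed_loop A B K1 K2 S mu a a0) ->
  output_regulated A B C D E F K1 K2 S mu a a0.
Proof.
move=> adiag PiS PiC hM x eta v vd xd etad i.
pose xt j t := x j t - Pi j *m v t.
pose et j t := eta j t - v t.
pose dxt j t := (A j + B j *m K1 j) *m xt j t + (B j *m K2 j) *m et j t.
pose det j t := S *m et j t - (mu * (\sum_k a j k + a0 j 0)) *: et j t + mu *: \sum_k a j k *: et k t.
pose z t := col_mx (\mxcol_j xt j t) (\mxcol_j et j t).
have clz t : closed_loop A B K1 K2 S mu a a0 *m z t = col_mx (\mxcol_j dxt j t) (\mxcol_j det j t).
  rewrite /closed_loop /z mul_block_col mul0mx add0r mul_mxdiag_mxcol !mul_mxblock_mxrow -mxcolD.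
  congr col_mx; apply/eq_mxcolP => j.
    congr (_ + _); rewrite (bigD1 j) //= eqxx big1 ?addr0 // => k kj.
    by rewrite eq_sym (negPf kj) mul0mx.
  rewrite /det (bigD1 j) //= eqxx mulmxBl -scalemxAl mul1mx; congr (_ + _).
  rewrite [in RHS](bigD1 j) //= adiag scale0r add0r scaler_sumr; apply: eq_bigr => k kj.
  by rewrite eq_sym (negPf kj) -scalemxAl mul1mx scalerA.
have dxtP j (t : R) l : is_derive t (1 : R) (fun s => xt j s l 0) (dxt j t l 0).
  have -> : (fun s => xt j s l 0) = (fun s => x j s l 0) - (fun s => (Pi j *m v s) l 0).
    by apply/funext => s; rewrite /xt mxE [X in _ + X]mxE.
  have xdl := is_derive_coord _ _ _ l 0 (xd j t).
  have vdl := is_derive_mulmx_coord (Pi j) v t _ l (fun k => is_derive_coord _ _ _ k 0 (vd t)).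
  apply: is_derive_eq.
  rewrite mulmxA PiS.
  have -> : dxt j t = (A j *m x j t + B j *m (K1 j *m x j t + K2 j *m eta j t) + E j *m v t)
     - (A j *m Pi j + B j *m (K1 j *m Pi j + K2 j) + E j) *m v t.
    rewrite /dxt /xt /et !(mulmxDl, mulmxDr, mulmxBr, mulmxBl, mulmxN, mulmxA).
    move: (A j *m x j t) (A j *m Pi j *m v t) (B j *m K1 j *m x j t) (B j *m K2 j *m v t).
    move: (B j *m K1 j *m Pi j *m v t) (B j *m K2 j *m eta j t) (E j *m v t).
    by move=> u1 u2 u3 u4 u5 u6 u7; apply/colP => k; rewrite !mxE; ring.
  by rewrite [in RHS]mxE [X in _ = _ + X]mxE.
have detP j (t : R) l : is_derive t (1 : R) (fun s => et j s l 0) (det j t l 0).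
  have -> : (fun s => et j s l 0) = (fun s => eta j s l 0) - (fun s => v s l 0).
    by apply/funext => s; rewrite /et mxE [X in _ + X]mxE.
  have edl := is_derive_coord _ _ _ l 0 (etad j t).
  have vdl := is_derive_coord _ _ _ l 0 (vd t).
  apply: is_derive_eq.
  have -> : det j t = (S *m eta j t + mu *: (\sum_k a j k *: (eta k t - eta j t)
                               + a0 j 0 *: (v t - eta j t))) - S *m v t.
    rewrite /det.
    (* Differences between followers are unchanged when [v] is subtracted from both. *)
    have -> : \sum_k a j k *: (eta k t - eta j t) =
        \sum_k a j k *: et k t - (\sum_k a j k) *: et j t.
      rewrite scaler_suml -sumrB; apply: eq_bigr => k _.
      by rewrite -scalerBr /et opprB addrA subrK.
    have -> : v t - eta j t = - et j t by rewrite opprB.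
    have -> : S *m eta j t = S *m et j t + S *m v t by rewrite -mulmxDr subrK.
    move: (\sum_k _ *: _) (et j t) (S *m _) (S *m _) => u1 u2 u3 u4.
    by apply/colP => k; rewrite !mxE; ring.
  by rewrite [in RHS]mxE [X in _ = _ + X]mxE.
have zd (t : R) k : is_derive t (1 : R) (fun s => z s k 0) ((closed_loop A B K1 K2 S mu a a0 *m z t) k 0).
  rewrite clz; case: (split_ordP k) => k' ->.
    rewrite col_mxEu mxE; under eq_fun do rewrite col_mxEu mxE; exact: dxtP.
  rewrite col_mxEd mxE; under eq_fun do rewrite col_mxEd mxE; exact: detP.
have z0 := hurwitz_decay _ _ hM zd.
have xt0 l : (xt i t l 0 @[t --> +oo] --> (0 : R))%classic.
  rewrite (_ : (fun t => xt i t l 0) = (fun t => z t (lshift _ (tagnat.Rank i l)) 0)) //.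
  apply/funext => t; rewrite col_mxEu.
  by rewrite -[xt i t in LHS](mxcolK (fun j => xt j t)) mxE.
have et0 l : (et i t l 0 @[t --> +oo] --> (0 : R))%classic.
  rewrite (_ : (fun t => et i t l 0) = (fun t => z t (rshift _ (tagnat.Rank i l)) 0)) //.
  apply/funext => t; rewrite col_mxEd.
  by rewrite -[et i t in LHS](mxcolK (fun j => et j t)) mxE.
have eE t : C i *m x i t + D i *m (K1 i *m x i t + K2 i *m eta i t) + F i *m v t =
   (C i + D i *m K1 i) *m xt i t + (D i *m K2 i) *m et i t.
  (* The subtracted term is zero by [PiC], and it cancels [F i *m v t]. *)
  rewrite -[LHS]subr0 -(mul0mx _ (v t)) -(PiC i) /xt /et.
  rewrite !(mulmxDl, mulmxDr, mulmxBr, mulmxBl, mulmxN, mulmxA).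
  move: (C i *m x i t) (C i *m Pi i *m v t) (D i *m K1 i *m x i t) (D i *m K2 i *m v t).
  move: (D i *m K1 i *m Pi i *m v t) (D i *m K2 i *m eta i t) (F i *m v t).
  by move=> u1 u2 u3 u4 u5 u6 u7; apply/colP => k; rewrite !mxE; ring.
apply: cvg_mx_coord0 => l j; rewrite ord1; under eq_fun do rewrite eE mxE.
have /cvgD/(_ (cvg_mulmx_coord0 (D i *m K2 i) _ l et0)) :=
  cvg_mulmx_coord0 (C i + D i *m K1 i) _ l xt0.
by rewrite addr0.
Qed.

(** * Gains constructed from the data *)

Theorem theorem4 (R : realType) (N : nat) (n m : 'I_N -> nat) (p q d : nat)
  (S : 'M[R]_q) (E : forall i, 'M[R]_(n i, q)) (F : forall i, 'M[R]_(p, q))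
  (Dd : 'M[R]_d.+1) (V : 'M[R]_(q, d.+1))
  (X : forall i, 'M[R]_(n i, d.+1)) (U : forall i, 'M[R]_(m i, d.+1))
  (Ecal : forall i, 'M[R]_(p, d.+1)) (eps1 eps2 : R) :
  0 < eps1 -> eps1 <= eps2 ->
  (forall lam : R[i], is_eig S lam -> 0 <= complex.Re lam) ->
  (forall i : 'I_N,
     exists Xp : 'M[R]_(d.+1, n i),
       X i *m Xp = 1%:M /\
       hurwitz ((X i *m Dd - E i *m V) *m Xp) /\
       (forall lam : R[i], is_eig S lam ->
          \rank (map_mx (real_complex R)
                   (col_mx (X i *m Dd - E i *m V) (Ecal i - F i *m V))
                 - col_mx (lam *: map_mx (real_complex R) (X i)) 0)
          = (n i + p)%N)) ->
  informative_COR S E F Dd V X U Ecal eps1 eps2.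
Proof.
move=> eps1_gt0 eps12 _ data A B C D cons.
(* A sigma type, so that the gains can be defined as dependent functions of [i]. *)
have sol i : { K : 'M[R]_(m i, n i) * ('M[R]_(n i, q) * 'M[R]_(m i, q)) |
    [/\ hurwitz (A i + B i *m K.1),
        K.2.1 *m S = A i *m K.2.1 + B i *m K.2.2 + E i &
        C i *m K.2.1 + D i *m K.2.2 + F i = 0] }.
  apply: cid; have [Xp [XXp [hX rk]]] := data i.
  have [|Pi [Gam [PiS PiC]]] := regulator_equations S (A i) (B i) (C i) (D i) (E i) (F i).
    by move=> lam /rk; exact: data_transmission_zero (cons i).
  exists (U i *m Xp, (Pi, Gam)); split=> //=.
  suff -> : A i + B i *m (U i *m Xp) = (X i *m Dd - E i *m V) *m Xp by [].
  by case: (cons i) => -> _; rewrite addrK mulmxDl -!mulmxA XXp mulmx1.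
pose K1 i := (sval (sol i)).1; pose Pi i := (sval (sol i)).2.1.
pose Gam i := (sval (sol i)).2.2.
have [r r_gt0 r_bound] := is_eig_bound S.
have [delta delta_gt0 weights] := admissible_graph_weights N eps1 eps2 eps1_gt0 eps12.
(* Eigenvalues of the grounded Laplacian have real part at least [delta], so the gain [r / delta]
   shifts the spectrum of [S] left by at least [r]. It is fixed before the graph: [r] comes from
   [S], and [delta] from [N], [eps1] and [eps2]. *)
exists K1, (fun i => Gam i - K1 i *m Pi i), (r / delta) => a a0 adm.
have [a_ge0 _ adiag _ _] := adm; have [w wP] := weights a a0 adm.
have GamE i : K1 i *m Pi i + (Gam i - K1 i *m Pi i) = Gam i by rewrite addrC subrK.
have hM : hurwitz (closed_loop A B K1 (fun i => Gam i - K1 i *m Pi i) S (r / delta) a a0).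
  apply: closed_loop_hurwitz => // [i|sig xi /r_bound sig_lt xi_eig].
    by rewrite /K1; case: (svalP (sol i)).
  apply: lt_le_trans sig_lt _; rewrite mulrAC ler_pdivlMr // ler_pM2l //.
  exact: follower_laplacian_eig a_ge0 adiag wP delta_gt0 _ xi_eig.
split=> //; apply: (hurwitz_output_regulated _ _ _ _ _ _ _ _ _ _ _ _ Pi) => // i.
  by rewrite GamE /Pi /Gam; case: (svalP (sol i)).
by rewrite GamE /Pi /Gam; case: (svalP (sol i)).
Qed.
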